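(* Let $\Omega$ be a non-empty compact metrizable space and $\tau$ an action of $\mathbb{Z}^l$ or of $(\mathbb{N}\cup\{0\})^l$ on $\Omega$ by continuous maps, for some $l\in\mathbb{N}$, such that the measure-theoretic entropy $h^\tau$ is finite and upper semi-continuous on $\mathcal{M}^\tau(\Omega)$. Let $f\in C(\Omega)$. Assume that there exists a vector subspace $V\subset C(\Omega)$, dense in $C(\Omega)$ for the uniform topology, such that $f+g$ has a unique equilibrium state for every $g\in V$. Then for each $\mu\in\mathcal{M}^\tau(\Omega)$ there exists a sequence $(\mu_n,g_n)_{n\in\mathbb{N}}$ in $\mathcal{M}^\tau(\Omega)\times V$ such that $\mu_n\to\mu$ in the weak-$*$ topology, $h^\tau(\mu_n)\to h^\tau(\mu)$, and for every $n$, $\mu_n$ is the (unique) equilibrium state for $f+g_n$.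
   Context: $C(\Omega)$ is the space of real-valued continuous functions on $\Omega$ with the uniform topology; $\mathcal{M}(\Omega)$ is the set of Borel probability measures on $\Omega$ with the weak-$*$ topology; $\mathcal{M}^\tau(\Omega)$ is the (compact) subset of $\tau$-invariant elements; $h^\tau(\mu)$ is the measure-theoretic entropy of $\mu\in\mathcal{M}^\tau(\Omega)$ for the action $\tau$. The pressure is $P^\tau(g)=\sup_{\mu\in\mathcal{M}^\tau(\Omega)}\{\mu(g)+h^\tau(\mu)\}$ for $g\in C(\Omega)$ (variational principle), where $\mu(g)=\int g\,d\mu$; an equilibrium state for $g$ is a $\mu\in\mathcal{M}^\tau(\Omega)$ attaining this supremum (which is a maximum under the standing assumptions). *)

(* Defs.v *)
From HB Require Import structures.
From mathcomp Require Import all_boot all_order all_algebra.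
From mathcomp Require Import all_classical all_reals all_analysis.

Set Implicit Arguments.
Unset Strict Implicit.
Unset Printing Implicit Defensive.

Import Order.TTheory GRing.Theory Num.Def Num.Theory.
Import numFieldTopology.Exports.

Local Open Scope classical_set_scope.
Local Open Scope ring_scope.

Inductive acting_monoid := ZZ | NN.

Definition amon_carrier (k : acting_monoid) : Type :=
  match k with ZZ => int | NN => nat end.

Definition amon_add (k : acting_monoid) :
  amon_carrier k -> amon_carrier k -> amon_carrier k :=
  match k return amon_carrier k -> amon_carrier k -> amon_carrier k with
  | ZZ => fun a b : int => (a + b)%R
  | NN => addn
  end.

Definition amon_of_nat (k : acting_monoid) (n : nat) : amon_carrier k :=
  match k return amon_carrier k with ZZ => (n%:Z)%R | NN => n end.

Definition lat (k : acting_monoid) (l : nat) : Type := 'I_l -> amon_carrier k.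

Definition lat_add k l (a b : lat k l) : lat k l := fun i => amon_add (a i) (b i).
Definition lat_zero k l : lat k l := fun _ => amon_of_nat k 0.

Definition box_pt k l n (a : {ffun 'I_l -> 'I_n}) : lat k l :=
  fun i => amon_of_nat k (a i).

Definition is_action (T : topologicalType) k l (tau : lat k l -> T -> T) : Prop :=
  [/\ (forall a, continuous (tau a)),
      (forall x, tau (@lat_zero k l) x = x) &
      (forall a b x, tau (lat_add a b) x = tau a (tau b x))].

Definition borel (T : ptopologicalType) := g_sigma_algebraType (@open T).

Section Thermo.
Variables (R : realType) (T : ptopologicalType) (k : acting_monoid) (l : nat)
  (tau : lat k l -> T -> T).

Local Notation B := (borel T).
Local Notation prob := (probability B R).

Definition pairing (mu : prob) (g : T -> R) : \bar R :=
  (\int[mu]_x (g x)%:E)%E.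

Definition tau_invariant (mu : prob) : Prop :=
  forall (a : lat k l) (A : set B), measurable A ->
    mu ((tau a) @^-1` A) = mu A.

Definition meas_partition (s : seq (set B)) : Prop :=
  [/\ (forall i, (i < size s)%N -> measurable (nth set0 s i)),
      (forall i j, (i < size s)%N -> (j < size s)%N -> i <> j ->
          nth set0 s i `&` nth set0 s j = set0) &
      (forall x : T, exists2 i, (i < size s)%N & nth set0 s i x)].

Definition entf (x : R) : R := if x == 0 then 0 else - (x * ln x).

(* H_mu of the join of tau_a^{-1} s over a in [0,n)^l : the atoms of the join
   are indexed by the maps c from the box to the indices of s *)
Definition join_entropy (mu : prob) (s : seq (set B)) (n : nat) : R :=
  \sum_(c : {ffun {ffun 'I_l -> 'I_n} -> 'I_(size s)})
     entf (fine (mu (\bigcap_(a in [set: {ffun 'I_l -> 'I_n}])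
                       ((tau (@box_pt k l n a)) @^-1` (nth set0 s (c a)))))).

(* h_mu(tau, s) = lim_n H_mu(s^{[0,n)^l}) / n^l  (limit exists; limsup taken) *)
Definition partition_entropy (mu : prob) (s : seq (set B)) : \bar R :=
  limn_esup (fun n => (join_entropy mu s n / ((n ^ l)%N)%:R)%:E).

Definition ms_entropy (mu : prob) : \bar R :=
  ereal_sup [set partition_entropy mu s | s in meas_partition].

(* pressure P^tau(g) via the variational principle *)
Definition pressure (g : T -> R) : \bar R :=
  ereal_sup [set (pairing mu g + ms_entropy mu)%E | mu in tau_invariant].

Definition equilibrium_state (g : T -> R) (mu : prob) : Prop :=
  tau_invariant mu /\ (pairing mu g + ms_entropy mu)%E = pressure g.

Definition unique_equilibrium_state (g : T -> R) : Prop :=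
  exists mu : prob, equilibrium_state g mu /\
    forall nu : prob, equilibrium_state g nu ->
      forall A : set B, measurable A -> nu A = mu A.

(* upper semi-continuity of h^tau on M^tau for the weak-* topology,
   using the basic weak-* neighbourhoods of mu *)
Definition entropy_usc : Prop :=
  forall mu : prob, tau_invariant mu -> forall c : R, (ms_entropy mu < c%:E)%E ->
    exists (m : nat) (gs : 'I_m -> T -> R) (e : R),
      [/\ 0 < e, (forall i, continuous (gs i)) &
        forall nu : prob, tau_invariant nu ->
          (forall i, (`| pairing nu (gs i) - pairing mu (gs i) | < e%:E)%E) ->
          (ms_entropy nu < c%:E)%E].

Definition weak_star_cvg (mu_ : nat -> prob) (mu : prob) : Prop :=
  forall g : T -> R, continuous g ->
    (fun n => pairing (mu_ n) g) @ \oo --> pairing mu g.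

End Thermo.

Definition dense_subspace_C (R : realType) (T : topologicalType)
  (V : set (T -> R)) : Prop :=
  [/\ V (fun _ => 0),
      (forall g h, V g -> V h -> V (fun x => g x + h x)),
      (forall (a : R) g, V g -> V (fun x => a * g x)),
      (forall g, V g -> continuous g) &
      (forall g, continuous g -> forall e : R, 0 < e ->
         exists2 v, V v & forall x, `| g x - v x | < e)].

(* Main.v *)
Require Import Defs.
From HB Require Import structures.
From mathcomp Require Import finmap all_boot all_order all_algebra.
From mathcomp Require Import all_classical all_reals all_analysis.
From mathcomp Require Import measurable_realfun ring lra.

Set Implicit Arguments.
Unset Strict Implicit.
Unset Printing Implicit Defensive.

Import Order.TTheory GRing.Theory Num.Def Num.Theory.
Import numFieldTopology.Exports.
Local Open Scope classical_set_scope.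
Local Open Scope ring_scope.

(** Call a normalized positive linear functional on the continuous functions a
mean.  A limit of means along an ultrafilter is a mean, and by the Riesz
representation theorem it is integration against a Borel probability; hence the
probabilities invariant under the action form a weak-* compact set.

The entropy [h] then matters only through its upper semicontinuity.  Write
[F mu = mu(f) + h(mu)] and, for [v_1, ..., v_m] in [V],
[phi mu = (mu(v_1), ..., mu(v_m))].  The envelope
[p u = max_mu (F mu + <u, phi mu>)] is the pressure of [f + sum_i u_i v_i], and
its maximizers share one value of [phi]; by compactness and semicontinuity this
value is the gradient of [p] at [u].  Minimizing
[p u - <u, phi mu> + (s / 2) |u|^2] over [R^m] therefore yields an equilibrium
state [nu] with [phi nu = phi mu - s u].  Comparing the minimum with the value
at [0] shows that [s |u|] tends to [0] with [s], and comparing [nu] with [mu] in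
the variational principle gives [F nu >= F mu].  Thus [nu] is close to [mu] on
the [v_i], the last inequality bounds [h(nu)] from below, and semicontinuity
bounds it from above.  A countable uniformly dense subset of [V] turns this into
a sequence. *)

(** * Means on continuous functions *)

Section mean.
Context {R : realType} {T : topologicalType}.
Implicit Types (L : (T -> R) -> R) (f g : T -> R) (a e M : R).

Definition is_mean L : Prop :=
  [/\ forall f g, continuous f -> continuous g ->
        L (fun x => f x + g x) = L f + L g,
      forall a f, continuous f -> L (fun x => a * f x) = a * L f,
      forall f, continuous f -> (forall x, 0 <= f x) -> 0 <= L f &
      L (fun=> 1) = 1].

Variable L : (T -> R) -> R.
Hypothesis meanL : is_mean L.

Lemma meanD f g : continuous f -> continuous g ->
  L (fun x => f x + g x) = L f + L g.
Proof. by case: meanL => + _ _ _; exact. Qed.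

Lemma meanZ a f : continuous f -> L (fun x => a * f x) = a * L f.
Proof. by case: meanL => _ + _ _; exact. Qed.

Lemma mean_ge0 f : continuous f -> (forall x, 0 <= f x) -> 0 <= L f.
Proof. by case: meanL => _ _ + _; exact. Qed.

Lemma mean_cst a : L (fun=> a) = a.
Proof.
have L1 : L (fun=> 1) = 1 by case: meanL.
rewrite -[RHS]mulr1 -L1 -meanZ; last exact: cst_continuous.
by congr L; apply/funext => x; rewrite mulr1.
Qed.

Lemma meanB f g : continuous f -> continuous g ->
  L (fun x => f x - g x) = L f - L g.
Proof.
move=> cf cg; rewrite -[- L g]mulN1r -meanZ// -meanD//.
  by congr L; apply/funext => x; rewrite mulN1r.
by move=> x; exact: cvgMl_tmp (cg x).
Qed.

Lemma le_mean f g : continuous f -> continuous g ->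
  (forall x, f x <= g x) -> L f <= L g.
Proof.
move=> cf cg fg; rewrite -subr_ge0 -meanB//; apply: mean_ge0 => x.
  by apply: cvgB; [exact: cg|exact: cf].
by rewrite subr_ge0.
Qed.

Lemma mean_sum (I : Type) (s : seq I) (F : I -> T -> R) :
  (forall i, continuous (F i)) ->
  L (fun x => \sum_(i <- s) F i x) = \sum_(i <- s) L (F i).
Proof.
move=> cF; elim: s => [|i s ih].
  by rewrite big_nil -[RHS](mean_cst 0); under eq_fun do rewrite big_nil.
rewrite big_cons -ih -meanD//; first by under eq_fun do rewrite big_cons.
by apply: continuous_big => //; exact: add_continuous.
Qed.

Lemma mean_dist f g e : continuous f -> continuous g ->
  (forall x, `|f x - g x| <= e) -> `|L f - L g| <= e.
Proof.
move=> cf cg fg; rewrite -meanB//.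
have cfg : continuous (fun x => f x - g x).
  by move=> x; apply: cvgB; [exact: cf|exact: cg].
rewrite ler_norml -{1}(mean_cst (- e)) -{2}(mean_cst e).
apply/andP; split; apply: le_mean => // [|x]; try exact: cst_continuous.
all: by have := fg x; rewrite ler_norml => /andP[].
Qed.

Lemma mean_norm_le f M : continuous f ->
  (forall x, `|f x| <= M) -> `|L f| <= M.
Proof.
move=> cf fM; rewrite -[L f]subr0 -(mean_cst 0); apply: mean_dist => // [|x].
  exact: cst_continuous.
by rewrite subr0.
Qed.

End mean.

Lemma continuous_compact_bounded (R : realType) (T : topologicalType)
    (f : T -> R) : compact [set: T] -> continuous f ->
  exists M, forall x, `|f x| <= M.
Proof.
move=> compactT cf.
have /compact_bounded[M [_ fM]] : compact (f @` setT).
  by apply: continuous_compact => //; exact: continuous_subspaceT.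
by exists (M + 1) => x; apply: (fM (M + 1)); [rewrite ltrDl|exists x].
Qed.

Lemma borel_open (T : ptopologicalType) (U : set T) :
  open U -> measurable (U : set (borel T)).
Proof. exact: sub_sigma_algebra. Qed.

Lemma continuous_borel_measurable (T U : ptopologicalType) (t : T -> U) :
  continuous t -> measurable_fun [set: borel T] (t : borel T -> borel U).
Proof.
move=> ct.
refine (@measurability _ _ (borel T) (borel U) setT t (@open U) erefl _).
move=> /= _ [A oA] <-; rewrite setTI; apply: borel_open.
by move/continuousP : ct; apply.
Qed.

Section borel_integral.
Context {R : realType} {T : ptopologicalType}.

Lemma continuous_borel_measurableR (f : T -> R) :
  continuous f -> measurable_fun [set: borel T] (f : borel T -> R).
Proof.
move=> cf; apply: (measurability _ (RGenOInfty.measurableE R)).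
move=> /= _ [_ [a ->]] <-; rewrite setTI; apply: borel_open.
by move/continuousP : cf; apply; exact: interval_open.
Qed.

Lemma eq_probability_open (P Q : probability (borel T) R) :
  (forall U, open U -> P U = Q U) -> forall A, measurable A -> P A = Q A.
Proof.
move=> PQ A mA; refine (@measure_unique _ _ (borel T) (@open T) (fun=> setT)
  erefl _ _ _ P Q PQ _ A mA).
- by move=> U V; exact: openI.
- by move=> _; exact: openT.
- by rewrite bigcup_const.
- move=> _; apply: (le_lt_trans (probability_le1 P measurableT)).
  exact: ltry.
Qed.

Hypothesis compactT : compact [set: T].
Variable P : probability (borel T) R.

Lemma continuous_integrable (f : T -> R) : continuous f ->
  P.-integrable [set: borel T] (EFin \o (f : borel T -> R)).
Proof.
move=> cf; have [M fM] := continuous_compact_bounded compactT cf.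
apply: measurable_bounded_integrable => //.
- by apply: (le_lt_trans (probability_le1 P measurableT)); rewrite ltry.
- exact: continuous_borel_measurableR.
- exists M; split; first exact: num_real.
  by move=> N MN x _ /=; rewrite (le_trans (fM x)) ?ltW.
Qed.

Lemma pairing_Rintegral (f : T -> R) :
  continuous f -> pairing P f = (\int[P]_x f x)%:E.
Proof.
move=> cf; rewrite /pairing /Rintegral fineK//.
exact: integrable_fin_num (continuous_integrable cf).
Qed.

Lemma Rintegral_mean : is_mean (fun f : T -> R => \int[P]_x f x).
Proof.
split=> [f g cf cg|a f cf|f cf f0|].
- by apply: RintegralD => //; exact: continuous_integrable.
- by apply: RintegralZl => //; exact: continuous_integrable.
- by apply: Rintegral_ge0 => x _; exact: f0.
- by rewrite Rintegral_cst//= (probability_setT P) mulr1.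
Qed.

End borel_integral.

(** * The Riesz representation of a mean *)

Section bump.
Context {R : realType} {T : topologicalType}.
Implicit Types (U V W : set T) (g h : T -> R) (e : R).

Definition bump U : set (T -> R) :=
  [set g : T -> R | [/\ continuous g, forall x, 0 <= g x <= 1 &
                        forall x, ~ U x -> g x = 0]].

Lemma bump0 U : bump U (fun=> 0).
Proof. by split=> // [|x]; [exact: cst_continuous|rewrite lexx ler01]. Qed.

Lemma subset_bump U V : U `<=` V -> bump U `<=` bump V.
Proof. by move=> UV g [cg g01 g0]; split=> // x nVx; apply: g0 => /UV. Qed.

Lemma bump1 : bump setT (fun=> 1).
Proof.
by split=> [|x|x []//]; [exact: cst_continuous|rewrite ler01 lexx].
Qed.

Lemma bump_bigmax U (I : Type) (s : seq I) (P : pred I) (g : I -> T -> R) :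
  (forall i, P i -> bump U (g i)) ->
  bump U (fun x => \big[maxr/0]_(i <- s | P i) g i x).
Proof.
move=> Ug; split=> [|x|x nUx].
- apply: continuous_big; first exact: max_continuous.
  by move=> i /Ug[].
- elim/big_ind : _ => [|a b /andP[a0 a1] /andP[b0 b1]|i /Ug[]//].
  + by rewrite lexx ler01.
  + by rewrite le_max a0 ge_max a1 b1.
- by apply: big1_idem => [|i /Ug[_ _]]; [exact: maxxx|exact].
Qed.

Lemma bumpD_cut W U g h e : 0 <= e -> bump (W `&` U) g ->
  bump (W `&` [set x | g x < e]) h ->
  bump W (fun x => maxr 0 (g x - e) + h x).
Proof.
move=> e0 [cg g01 g0] [ch h01 h0]; split=> [x|x|x nWx].
- apply: cvgD (ch x); apply: (@continuous_max R T (fun=> 0)).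
    exact: cst_continuous.
  by apply: cvgB; [exact: cg|exact: cvg_cst].
- have /andP[gx0 gx1] := g01 x; have /andP[hx0 hx1] := h01 x.
  have [gx|gx] := ltP (g x) e; first by rewrite max_l; lra.
  by rewrite h0; [rewrite max_r; lra|case=> _ /=; rewrite ltNge gx].
- by rewrite g0; [rewrite h0; [rewrite max_l; lra|case]|case].
Qed.

End bump.

Lemma exists_bump (R : realType) (T : uniformType) (U : set T) (x : T) :
  open U -> U x -> exists2 g : T -> R, bump U g & g x = 1.
Proof.
move=> oU Ux; have nUx : ~ (~` U) x by move/(_ Ux).
have /(uniform_separatorP (R := R))[f [cf f01 f0 f1]] :=
  @point_uniform_separator R _ _ _ (open_closedC oU) nUx.
exists (fun y => 1 - f y); last by rewrite (f0 (f x)) ?subr0//; exists x.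
split=> [y|y|y nUy].
- by apply: cvgB; [exact: cvg_cst|exact: cf].
- have : `[0, 1]%classic (f y) by apply: f01; exists y.
  by rewrite /= in_itv/= => /andP[? ?]; lra.
- by rewrite (f1 (f y)) ?subrr//; exists y.
Qed.

Lemma bump_bigcup_le (R : realType) (T : puniformType) (U : nat -> set T)
    (g : T -> R) (e : R) : compact [set: T] ->
  (forall n, open (U n)) -> bump (\bigcup_n U n) g -> 0 < e ->
  exists (N : nat) (psi : nat -> T -> R), (forall n, bump (U n) (psi n)) /\
    forall x, g x <= \sum_(n < N) psi n x + e.
Proof.
move=> compactT oU [cg g01 g0] e0.
have /choice[f fP] : forall x, exists p : nat * (T -> R),
    bump (U p.1) p.2 /\ g x < p.2 x + e.
  move=> x; have [[n _ Unx]|nUx] := pselect ((\bigcup_n U n) x).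
    have [phi Uphi phix] := exists_bump R (oU n) Unx; exists (n, phi).
    by split=> //=; rewrite phix; have /andP[_ gx1] := g01 x; lra.
  by exists (0%N, fun=> 0); split; [exact: bump0|rewrite g0//= add0r].
have := compactT; rewrite compact_cover.
move=> /(_ T setT (fun x => [set y | 0 < (f x).2 y + e - g y])).
case=> [x _|x _|D _ covD].
- have cD : continuous (fun y => (f x).2 y + e - g y).
    move=> y; apply: cvgB (cg y); apply: cvgD; last exact: cvg_cst.
    by have [[+ _ _] _] := fP x; exact.
  by move/continuousP : cD => /(_ _ (@open_gt R 0)).
- by exists x => //=; rewrite subr_gt0; case: (fP x).
pose N := (\max_(x <- enum_fset D) (f x).1).+1.
pose psi n y := \big[maxr/0]_(x <- enum_fset D | (f x).1 == n) (f x).2 y.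
have Upsi n : bump (U n) (psi n).
  by apply: bump_bigmax => x /eqP <-; case: (fP x).
exists N, psi; split=> // y; have [x /= xD] := covD y I.
rewrite subr_gt0 => /ltW/le_trans; apply; rewrite lerD2r.
have xN : ((f x).1 < N)%N by rewrite ltnS; apply: leq_bigmax_seq.
rewrite (bigD1 (Ordinal xN))//= ler_wpDr//.
  by apply: sumr_ge0 => n _; have [_ /(_ y)/andP[]] := Upsi n.
exact: (le_bigmax_seq 0 x (fun z => (f z).1 == _) (fun z => (f z).2 y)).
Qed.

Section riesz_measure.
Context {R : realType} {T : puniformType} (L : (T -> R) -> R).
Hypothesis compactT : compact [set: T].
Hypothesis meanL : is_mean L.
Local Open Scope ereal_scope.

Definition open_mass (U : set T) : \bar R :=
  ereal_sup [set (L g)%:E | g in bump U].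

Definition outer_mass (A : set T) : \bar R :=
  ereal_inf [set open_mass U | U in [set U | open U /\ A `<=` U]].

Lemma mean_le_open_mass U g : bump U g -> (L g)%:E <= open_mass U.
Proof. by move=> Ug; apply: ereal_sup_ubound; exists g. Qed.

Lemma open_mass_ge0 U : 0 <= open_mass U.
Proof.
rewrite -[0]/(0%R%:E) -(mean_cst meanL 0); apply: mean_le_open_mass.
exact: bump0.
Qed.

Lemma le_open_mass U V : U `<=` V -> open_mass U <= open_mass V.
Proof.
move=> UV; apply: ge_ereal_sup => _ [g Ug <-]; apply: mean_le_open_mass.
exact: subset_bump Ug.
Qed.

Lemma open_mass_le1 U : open_mass U <= 1.
Proof.
apply: ge_ereal_sup => _ [g [cg g01 _] <-]; rewrite lee_fin -(mean_cst meanL 1).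
apply: le_mean => // [|x]; first exact: cst_continuous.
by case/andP: (g01 x).
Qed.

Lemma open_mass_fin U : open_mass U \is a fin_num.
Proof.
rewrite ge0_fin_numE ?open_mass_ge0//.
by apply: le_lt_trans (open_mass_le1 U) _; rewrite ltry.
Qed.

Lemma open_mass0 : open_mass set0 = 0.
Proof.
apply/eqP; rewrite eq_le open_mass_ge0 andbT.
apply: ge_ereal_sup => _ [g [_ _ g0] <-].
rewrite lee_fin -[leRHS](mean_cst meanL) (_ : g = fun=> 0%R)//.
by apply/funext => x; rewrite g0.
Qed.

Lemma open_massT : open_mass setT = 1.
Proof.
apply/eqP; rewrite eq_le open_mass_le1/= -[1]/(1%R%:E) -(mean_cst meanL 1).
by apply: mean_le_open_mass; exact: bump1.
Qed.

Lemma open_mass_bigcup (U : nat -> set T) : (forall n, open (U n)) ->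
  open_mass (\bigcup_n U n) <= \sum_(n <oo) open_mass (U n).
Proof.
move=> oU; apply: ge_ereal_sup => _ [g Ug <-]; apply/lee_addgt0Pr => e e0.
have [N [psi [Upsi g_le]]] := bump_bigcup_le compactT oU Ug e0.
have cpsi n : continuous (psi n) by case: (Upsi n).
have csum : continuous (fun x => \sum_(n < N) psi n x)%R.
  by apply: continuous_big => //; exact: add_continuous.
have ce : continuous (fun=> e : R) := @cst_continuous T R e.
apply: (@le_trans _ _ (\sum_(n < N) L (psi n) + e)%:E).
  rewrite lee_fin -(mean_sum meanL)// -[X in (_ + X)%R](mean_cst meanL).
  rewrite -(meanD meanL)//.
  apply: (le_mean meanL) => //; first by case: Ug.
  by move=> x; apply: cvgD; [exact: csum|exact: ce].
rewrite EFinD leeD2r// -sumEFin.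
apply: (@le_trans _ _ (\sum_(0 <= n < N) open_mass (U n))).
  by rewrite big_mkord; apply: lee_sum => n _; exact: mean_le_open_mass.
by apply: nneseries_lim_ge => n _ _; exact: open_mass_ge0.
Qed.

Lemma outer_mass_open U : open U -> outer_mass U = open_mass U.
Proof.
move=> oU; apply/eqP; rewrite eq_le; apply/andP; split.
  by apply: ereal_inf_lbound; exists U => //; split.
by apply: le_ereal_inf_tmp => _ [V [oV UV] <-]; exact: le_open_mass.
Qed.

Let outer_mass_le U A : open U -> A `<=` U -> outer_mass A <= open_mass U.
Proof. by move=> oU AU; apply: ereal_inf_lbound; exists U. Qed.

Let outer_mass_ge0 A : 0 <= outer_mass A.
Proof. by apply: le_ereal_inf_tmp => _ [V _ <-]; exact: open_mass_ge0. Qed.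

Let outer_mass_fin A : outer_mass A \is a fin_num.
Proof.
rewrite ge0_fin_numE//.
apply: le_lt_trans (outer_mass_le openT (@subsetT _ A)) _.
by rewrite open_massT ltry.
Qed.

Let outer_mass0 : outer_mass set0 = 0.
Proof. by rewrite outer_mass_open ?open_mass0//; exact: open0. Qed.

Let le_outer_mass : {homo outer_mass : A B / A `<=` B >-> A <= B}.
Proof.
move=> A B AB; apply: le_ereal_inf_tmp => _ [V [oV BV] <-].
by apply: outer_mass_le => //; exact: subset_trans BV.
Qed.

Let outer_mass_adherent A (e : R) : (0 < e)%R ->
  exists U, [/\ open U, A `<=` U & open_mass U <= outer_mass A + e%:E].
Proof.
move=> e0; have [_ [U [oU AU] <-] /ltW ?] :=
  lb_ereal_inf_adherent e0 (outer_mass_fin A).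
by exists U.
Qed.

Let outer_mass_sigma_subadditive : sigma_subadditive outer_mass.
Proof.
move=> A; apply/lee_addgt0Pr => e e0.
rewrite (le_trans _ (epsilon_trick _ _ (ltW e0)))//.
have /choice[U PU] : forall n, exists U, [/\ open U, A n `<=` U &
    open_mass U <= outer_mass (A n) + (e / (2 ^ n.+1)%:R)%:E].
  by move=> n; apply: outer_mass_adherent; rewrite divr_gt0// ltr0n expn_gt0.
have oU n : open (U n) by case: (PU n).
apply: (@le_trans _ _ (open_mass (\bigcup_n U n))).
  apply: outer_mass_le; first exact: bigcup_open.
  by apply: subset_bigcup => n _; case: (PU n).
apply: le_trans (open_mass_bigcup oU) _.
by apply: lee_nneseries => n _; [move=> _; exact: open_mass_ge0|case: (PU n)].
Qed.

HB.instance Definition _ := isOuterMeasure.Build R T outer_mass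
  outer_mass0 outer_mass_ge0 le_outer_mass outer_mass_sigma_subadditive.

Lemma open_massIC_le W U : open W -> open U ->
  open_mass (W `&` U) + outer_mass (W `&` ~` U) <= open_mass W.
Proof.
move=> oW oU; apply/lee_addgt0Pr => e e0; have e3 : (0 < e / 3)%R by lra.
have [_ [g Ug <-] gM] := ub_ereal_sup_adherent e3 (open_mass_fin (W `&` U)).
have [cg _ g0] := Ug; pose O := W `&` [set x | (g x < e / 3)%R].
have oO : open O.
  by apply: openI => //; move/continuousP : cg => /(_ _ (@open_lt R (e / 3))).
have WO : W `&` ~` U `<=` O.
  by move=> x [Wx nUx]; split=> //=; rewrite g0// => -[].
have [_ [h Oh <-] hM] := ub_ereal_sup_adherent e3 (open_mass_fin O).
have ch : continuous h by case: Oh.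
have Wgh := bumpD_cut (ltW e3) Ug Oh; have [cgh _ _] := Wgh.
have Lgh : (L g - e / 3 + L h <= L (fun x => maxr 0 (g x - e / 3) + h x))%R.
  have c3 : continuous (fun=> e / 3 : R)%R := @cst_continuous T R _.
  have cg3 : continuous (fun x => g x - e / 3)%R.
    by move=> x; apply: cvgB; [exact: cg|exact: c3].
  rewrite -[X in (_ - X)%R](mean_cst meanL) -(meanB meanL)// -(meanD meanL)//.
  apply: (le_mean meanL) => // x; last by rewrite lerD2r le_max lexx orbT.
  by apply: cvgD; [exact: cg3|exact: ch].
move: (mean_le_open_mass Wgh) (outer_mass_le oO WO) gM hM Lgh.
rewrite -/(open_mass _) -/(open_mass _).
rewrite -(fineK (open_mass_fin (W `&` U))) -(fineK (open_mass_fin O)).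
rewrite -(fineK (open_mass_fin W)) -(fineK (outer_mass_fin (W `&` ~` U))).
by rewrite -!EFinN -!EFinD !lee_fin !lte_fin; lra.
Qed.

Lemma open_caratheodory U : open U -> outer_mass.-caratheodory U.
Proof.
move=> oU; apply: le_caratheodory_measurable => A.
apply/lee_addgt0Pr => /= e e0; have [W [oW AW WA]] := outer_mass_adherent A e0.
apply: le_trans WA; apply: le_trans (open_massIC_le oW oU).
apply: leeD; last by apply: le_outer_mass; exact: setSI.
by apply: outer_mass_le; [exact: openI|exact: setSI].
Qed.

Let borel_caratheodory (A : set (borel T)) :
  measurable A -> outer_mass.-caratheodory A.
Proof.
apply: smallest_sub; last exact: open_caratheodory.
split=> [|B|B].
- exact: caratheodory_measurable_set0.
- by rewrite setTD; exact: caratheodory_measurable_setC.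
- exact: caratheodory_measurable_bigcup.
Qed.

Let outer_mass_sigma_additive :
  semi_sigma_additive (outer_mass : set (borel T) -> \bar R).
Proof.
move=> A mA tA mUA; apply: (@caratheodory_measure_sigma_additive R T) => //.
- by move=> i; exact: borel_caratheodory.
- exact: borel_caratheodory.
Qed.

Lemma open_mass_probability :
  exists P : probability (borel T) R, forall U, open U -> P U = open_mass U.
Proof.
have outer_massT : outer_mass setT = 1.
  by rewrite outer_mass_open ?open_massT//; exact: openT.
pose mu : set (borel T) -> \bar R := outer_mass.
pose m := isMeasure.Build _ _ _ mu
  outer_mass0 outer_mass_ge0 outer_mass_sigma_additive.
pose M : {measure set (borel T) -> \bar R} := HB.pack mu m.
pose p := Measure_isProbability.Build _ _ _ M outer_massT.
pose P : probability (borel T) R := HB.pack mu m p.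
by exists P => U oU; exact: outer_mass_open.
Qed.

End riesz_measure.

Lemma eq_mean_le01 (R : realType) (T : topologicalType) (L M : (T -> R) -> R) :
  compact [set: T] -> is_mean L -> is_mean M ->
  (forall g : T -> R, continuous g ->
    (forall x, 0 <= g x <= 1) -> L g <= M g) ->
  forall g, continuous g -> L g = M g.
Proof.
move=> compactT meanL meanM LM.
have LM01 (g : T -> R) : continuous g ->
    (forall x, 0 <= g x <= 1) -> L g = M g.
  move=> cg g01; apply/eqP; rewrite eq_le LM//=.
  have c1 : continuous (fun=> 1 : R) := @cst_continuous T R 1.
  have cg1 : continuous (fun x => 1 - g x).
    by move=> x; apply: cvgB; [exact: c1|exact: cg].
  rewrite -[leRHS]opprK -[leLHS]opprK lerN2 -(lerD2l 1).
  rewrite -[X in X - _ <= _](mean_cst meanL 1).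
  rewrite -[X in _ <= X - _](mean_cst meanM 1).
  rewrite -(meanB meanL)// -(meanB meanM)//; apply: LM => // x.
  by have := g01 x; lra.
move=> g cg; have [B gB] := continuous_compact_bounded compactT cg.
pose a := `|B| + 1; have a0 : 0 < a by rewrite ltr_wpDl.
pose h x := (2 * a)^-1 * (g x + a).
have ca : continuous (fun=> a) := @cst_continuous T R a.
have cga : continuous (fun x => g x + a).
  by move=> x; apply: cvgD; [exact: cg|exact: ca].
have ch : continuous h by move=> x; exact: cvgMl_tmp (cga x).
have gh K : is_mean K -> K g = 2 * a * K h - a.
  move=> meanK; rewrite (meanZ meanK)// mulVKf ?mulf_neq0 ?gt_eqF//.
  by rewrite (meanD meanK)// (mean_cst meanK) addrK.
rewrite !gh// LM01// => x.
rewrite /h mulrC ler_pdivlMr ?ler_pdivrMr ?mulr_gt0//.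
have := le_trans (gB x) (ler_norm B).
by rewrite mul0r mul1r ler_norml /a; lra.
Qed.

Section slices.
Context {R : realType}.
Implicit Types (N j : nat) (y : R).

Definition slice j y := minr 1 (maxr 0 (y - j%:R)).

Lemma slice_ge0_le1 j y : 0 <= slice j y <= 1.
Proof. by rewrite le_min ler01 le_max lexx ge_min lexx. Qed.

Lemma slice_eq0 j y : y <= j%:R -> slice j y = 0.
Proof. by move=> yj; rewrite /slice max_l ?subr_le0// min_r. Qed.

Lemma continuous_slice j : continuous (slice j).
Proof.
rewrite (_ : slice j = (fun=> 1) \min ((fun=> 0) \max (fun y => y - j%:R)))//.
move=> y; apply: continuous_min; first exact: cvg_cst.
apply: continuous_max; first exact: cvg_cst.
by apply: cvgB; [exact: cvg_id|exact: cvg_cst].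
Qed.

Lemma sum_slice N y : 0 <= y -> \sum_(j < N) slice j y = minr N%:R y.
Proof.
move=> y0; elim: N => [|N ih]; first by rewrite big_ord0 min_l.
rewrite big_ord_recr/= ih -natr1 /slice.
have [yN|Ny] := leP y N%:R.
  by rewrite max_l ?subr_le0// min_r ?addr0// [RHS]min_r//; lra.
rewrite max_r; last by lra.
by have [?|?] := leP 1 (y - N%:R); have [?|?] := leP (N%:R + 1) y; lra.
Qed.

Lemma sum_ltr_nat_le N y : 0 <= y ->
  \sum_(j < N) (j%:R < y)%R%:R <= minr N%:R (y + 1).
Proof.
move=> y0; elim: N => [|N]; first by rewrite big_ord0 le_min lexx; lra.
rewrite big_ord_recr/= -natr1 !le_min => /andP[ihN ihy].
by have [Ny|yN] := ltP N%:R y; rewrite /= ?mulr1n ?mulr0n; lra.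
Qed.

End slices.

Lemma sum_probability_le_Rintegral d (T : measurableType d) (R : realType)
    (P : probability T R) (N : nat) (A : 'I_N -> set T) (f : T -> R) :
  (forall j, measurable (A j)) -> P.-integrable setT (EFin \o f) ->
  (forall x, \sum_(j < N) \1_(A j) x <= f x) ->
  \sum_(j < N) fine (P (A j)) <= \int[P]_x f x.
Proof.
move=> mA intf Af.
rewrite -lee_fin /Rintegral fineK; last exact: integrable_fin_num.
rewrite -sumEFin; under eq_bigr => j _ do
  rewrite fineK ?fin_num_measure// -[A j]setIT -integral_indic//.
rewrite -integral_sum//; last by move=> j; exact: integrable_indic.
apply: le_integral => // [|x _].
  by apply: integrable_sum => // j _; exact: integrable_indic.
by rewrite sumEFin lee_fin.
Qed.

Section mean_le_Rintegral.
Context {R : realType} {T : ptopologicalType} (L : (T -> R) -> R).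
Variable P : probability (borel T) R.
Hypothesis compactT : compact [set: T].
Hypothesis meanL : is_mean L.
Hypothesis bump_le : forall U g, open U -> bump U g -> ((L g)%:E <= P U)%E.

Let mean_le_Rintegral_add1 (h : T -> R) :
  continuous h -> (forall x, 0 <= h x) -> L h <= \int[P]_x h x + 1.
Proof.
move=> ch h0; have [B hB] := continuous_compact_bounded compactT ch.
pose N := (truncn B).+1.
have hN x : h x <= N%:R.
  exact: le_trans (le_trans (ler_norm _) (hB x)) (ltW (truncnS_gt _)).
pose A j := [set x | j%:R < h x].
have oA j : open (A j) by move/continuousP : ch => /(_ _ (@open_gt R j%:R)).
have mA j : measurable (A j : set (borel T)) by exact: borel_open.
have bump_slice j : bump (A j) (fun x => slice j (h x)).
  split=> [x|x|x /negP]; last by rewrite -leNgt => /slice_eq0.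
  - by apply: continuous_comp; [exact: ch|exact: continuous_slice].
  - exact: slice_ge0_le1.
have -> : L h = \sum_(j < N) L (fun x => slice j (h x)).
  rewrite -(mean_sum meanL); last by move=> j; case: (bump_slice j).
  by congr L; apply/funext => x; rewrite sum_slice// min_r.
apply: (@le_trans _ _ (\sum_(j < N) fine (P (A j)))).
  apply: ler_sum => j _; rewrite -lee_fin fineK ?fin_num_measure//.
  exact: bump_le.
have c1 : continuous (fun=> 1 : R) := @cst_continuous T R 1.
have ch1 : continuous (fun x => h x + 1).
  by move=> x; apply: cvgD; [exact: ch|exact: c1].
have meanP := Rintegral_mean compactT P.
rewrite -[X in _ <= _ + X](mean_cst meanP 1) -(meanD meanP ch c1).
apply: sum_probability_le_Rintegral => // [|x].
  exact: continuous_integrable.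
under eq_bigr do rewrite indicE mem_setE.
by have := sum_ltr_nat_le N (h0 x); rewrite le_min => /andP[].
Qed.

Lemma mean_le_Rintegral (g : T -> R) :
  continuous g -> (forall x, 0 <= g x) -> L g <= \int[P]_x g x.
Proof.
move=> cg g0; apply/ler_addgt0Pr => e e0; pose N := (truncn e^-1).+1.
have N0 : 0 < N%:R :> R by rewrite ltr0n.
have cNg : continuous (fun x => N%:R * g x).
  by move=> x; apply: cvgMl_tmp; exact: cg.
rewrite -(ler_pM2l N0) -(meanZ meanL)//.
have Ng0 x : 0 <= N%:R * g x by exact: mulr_ge0.
apply: le_trans (mean_le_Rintegral_add1 cNg Ng0) _.
rewrite (meanZ (Rintegral_mean compactT P))// mulrDr lerD2l.
rewrite -ler_pdivrMl// mulr1 invf_ple ?posrE//.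
exact: ltW (truncnS_gt _).
Qed.

End mean_le_Rintegral.

Theorem riesz_representation (R : realType) (T : puniformType)
    (L : (T -> R) -> R) : compact [set: T] -> is_mean L ->
  exists P : probability (borel T) R,
    forall g, continuous g -> L g = \int[P]_x g x.
Proof.
move=> compactT meanL; have [P PE] := open_mass_probability compactT meanL.
exists P; apply: eq_mean_le01 => //; first exact: Rintegral_mean.
move=> g cg g01; apply: mean_le_Rintegral => // [U h oU Uh|x].
  by rewrite PE//; exact: mean_le_open_mass.
by case/andP: (g01 x).
Qed.

(** * The weak-* topology on Borel probabilities *)

HB.instance Definition _ (R : realType) (T : ptopologicalType) :=
  Topological.copy (probability (borel T) R)
    (sup_topology (fun g : {g : T -> R | continuous g} => Topological.on
      (initial_topology
        (fun P : probability (borel T) R => \int[P]_x sval g x)))).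

Section weak_star_topology.
Context {R : realType} {T : ptopologicalType}.
Local Notation prob := (probability (borel T) R).

Lemma weak_star_cvgP (F : set_system prob) (P : prob) : Filter F ->
  F --> P <-> forall g : T -> R, continuous g ->
    (fun Q : prob => \int[Q]_x g x) @ F --> \int[P]_x g x.
Proof.
move=> FF; apply: (iff_trans (cvg_sup _ _ _)); split=> [FP g cg|FP [g cg]].
  apply: cvg_trans (@initial_continuous prob R (fun Q => \int[Q]_x g x) P).
  exact/cvg_app/(FP (exist _ g cg)).
move=> A; rewrite nbhsE => -[_ [[B oB <-] BP] BA].
apply: filterS BA _; apply: (FP g cg); exact: open_nbhs_nbhs.
Qed.

Lemma continuous_Rintegral (g : T -> R) : continuous g ->
  continuous (fun P : prob => \int[P]_x g x).
Proof. by move=> cg P; exact: (weak_star_cvgP P (nbhs_filter P)).1 _ g cg. Qed.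

End weak_star_topology.

Section ultralimit.
Context {R : realType} {T : topologicalType} {I : Type} {F : set_system I}.
Context (UF : UltraFilter F) (L_ : I -> (T -> R) -> R).
Hypothesis compactT : compact [set: T].
Hypothesis meanL : forall i, is_mean (L_ i).

Let FF : ProperFilter F := ultra_proper.

Lemma ultra_cvg_mean (g : T -> R) : continuous g -> cvg (L_ i g @[i --> F]).
Proof.
move=> cg; have [M gM] := continuous_compact_bounded compactT cg.
have FM : F [set i | `[- M, M]%classic (L_ i g)].
  by apply: nearW => i /=; rewrite in_itv/= -ler_norml; exact: mean_norm_le.
have [l [_ clusterl]] := @segment_compact R (- M) M (L_ i g @[i --> F]) _ FM.
apply/cvg_ex; exists l => B lB.
have [//|FnB] := in_ultra_setVsetC [set i | B (L_ i g)] UF.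
by have [z []] := clusterl (~` B) B FnB lB.
Qed.

Lemma ultralimit_mean : is_mean (fun g => lim (L_ i g @[i --> F])).
Proof.
split=> [g h cg ch|a g cg|g cg g0|].
- apply: cvg_lim => //; under eq_fun do rewrite meanD//.
  by apply: cvgD; exact: ultra_cvg_mean.
- apply: cvg_lim => //; under eq_fun do rewrite meanZ//.
  by apply: cvgMl_tmp; exact: ultra_cvg_mean.
- apply: limr_ge; first exact: ultra_cvg_mean.
  by apply: nearW => i; exact: mean_ge0.
- under eq_fun do rewrite mean_cst//.
  exact: lim_cst.
Qed.

End ultralimit.

Theorem compact_probability (R : realType) (T : puniformType) :
  compact [set: T] -> compact [set: probability (borel T) R].
Proof.
move=> compactT; rewrite compact_ultra => F UF _.
have FF : ProperFilter F := ultra_proper.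
pose L_ (P : probability (borel T) R) (g : T -> R) := \int[P]_x g x.
have meanL P : is_mean (L_ P) := Rintegral_mean compactT P.
have [P LP] :=
  riesz_representation compactT (ultralimit_mean UF compactT meanL).
exists P; split=> //; apply/weak_star_cvgP => g cg.
by rewrite -LP//; exact: ultra_cvg_mean.
Qed.

Section pseudometric_probability.
Context {R : realType} {T : pseudoPMetricType R}.
Local Notation prob := (probability (borel T) R).

Lemma exists_continuous_cvg_indic (U : set T) : open U ->
  exists u : nat -> T -> R, [/\ forall n, continuous (u n),
    forall n x, 0 <= u n x <= 1 & forall x, u ^~ x @ \oo --> (\1_U x : R)].
Proof.
move=> oU; pose A n : set T := [set x | ball x n.+1%:R^-1 `<=` U].
have sep n : uniform_separator (~` U) (A n).
  apply: uniform_separatorW; exists [set xy | ball xy.1 n.+1%:R^-1 xy.2].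
    by rewrite -entourage_ballE; exists n.+1%:R^-1 => //=; rewrite invr_gt0.
  by rewrite -subset0 => -[x y] [[/= nUx Ay] /ball_sym/Ay].
have /choice[u u_sep] n := (uniform_separatorP (R := R) _ _).1 (sep n).
exists u; split=> [n|n x|x]; first by case: (u_sep n).
  have [_ u01 _ _] := u_sep n.
  by have : `[0, 1]%classic (u n x); [apply: u01; exists x|rewrite /= in_itv].
rewrite indicE; have [xU|xU] := boolP (x \in U); last first.
  apply: cvg_near_cst; apply: nearW => n; have [_ _ + _] := u_sep n; apply.
  by exists x => //; move/negP: xU; apply: contra_not => /mem_set.
have /nbhs_ballP[r /= r0 rU] := open_nbhs_nbhs (conj oU (set_mem xU)).
apply: cvg_near_cst; near=> n; have [_ _ _] := u_sep n; apply; exists x => //=.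
apply: subset_trans rU; apply: le_ball; apply: ltW.
near: n; exact: near_infty_natSinv_lt (PosNum r0).
Unshelve. all: by end_near. Qed.

Hypothesis compactT : compact [set: T].

Lemma eq_probability_Rintegral (P Q : prob) :
  (forall g : T -> R, continuous g -> \int[P]_x g x = \int[Q]_x g x) ->
  forall A, measurable A -> P A = Q A.
Proof.
move=> PQ; apply: eq_probability_open => U oU; have mU := borel_open oU.
have [u [cu u01 uU]] := exists_continuous_cvg_indic oU.
have cvgU (mu : prob) : (\int[mu]_x (u n x)%:E)%E @[n --> \oo] --> mu U.
  rewrite -[U in mu U]setIT -integral_indic//.
  apply: (@dominated_cvg _ (borel T) R mu setT measurableT
    (fun n x => (u n x)%:E) (fun x => (\1_U x)%:E) (EFin \o cst 1)).
  - move=> n; apply/measurable_EFinP.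
    exact: (continuous_borel_measurableR (cu n)).
  - by move=> x _; apply: cvg_EFin; [exact: nearW|exact: uU].
  - by [].
  - exact: finite_measure_integrable_cst.
  - by move=> n x _; rewrite lee_fin ger0_norm; case/andP: (u01 n x).
have PQu : (fun n => pairing P (u n)) = (fun n => pairing Q (u n)).
  by apply/funext => n; rewrite !pairing_Rintegral// PQ.
apply: (cvg_unique (@ereal_hausdorff R) (cvgU P)).
by have := cvgU Q; rewrite -/(pairing Q _) -PQu.
Qed.

End pseudometric_probability.

Definition measure_preserving (R : realType) (T : ptopologicalType) (t : T -> T)
    (P : probability (borel T) R) : Prop :=
  forall A : set (borel T), measurable A -> P (t @^-1` A) = P A.

Section measure_preserving.
Context {R : realType} {T : pseudoPMetricType R}.
Variable t : T -> T.
Hypothesis compactT : compact [set: T].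
Hypothesis ct : continuous t.
Local Notation prob := (probability (borel T) R).

Lemma measure_preservingP (P : prob) : measure_preserving t P <->
  forall g : T -> R, continuous g -> \int[P]_x g (t x) = \int[P]_x g x.
Proof.
pose X : {mfun borel T >-> borel T} :=
  mfun_Sub (mem_set (continuous_borel_measurable ct)).
have push (g : T -> R) : continuous g ->
    \int[distribution P X]_x g x = \int[P]_x g (t x).
  move=> cg; congr fine; apply: integral_distribution.
    by apply/measurable_EFinP; exact: (continuous_borel_measurableR cg).
  apply: (@continuous_integrable R T compactT P (g \o t)) => x.
  by apply: continuous_comp; [exact: ct|exact: cg].
split=> [tP g cg|tP A mA].
  rewrite -push//; congr fine; apply: eq_measure_integral => A mA _.
  exact: tP.
apply: (@eq_probability_Rintegral _ _ compactT (distribution P X) P) => //.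
by move=> g cg; rewrite push//; exact: tP.
Qed.

Lemma closed_measure_preserving :
  closed [set P : prob | measure_preserving t P].
Proof.
rewrite (_ : mkset _ = \bigcap_(g in [set g : T -> R | continuous g])
    [set P : prob | \int[P]_x g (t x) - \int[P]_x g x = 0]).
  apply: closed_bigI => g /= cg.
  have cgt : continuous (g \o t).
    by move=> x; apply: continuous_comp; [exact: ct|exact: cg].
  have cd : continuous (fun P : prob => \int[P]_x g (t x) - \int[P]_x g x).
    move=> P; apply: (cvgB (F := nbhs P)); last exact: continuous_Rintegral.
    exact: (continuous_Rintegral cgt).
  by move/continuous_closedP : cd => /(_ _ (@closed_eq R 0)).
apply/seteqP; split=> P /=.
  by move/measure_preservingP => tP g cg /=; rewrite tP// subrr.
move=> tP; apply/measure_preservingP => g cg.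
by apply/eqP; rewrite -subr_eq0; apply/eqP/tP.
Qed.

End measure_preserving.

(** * Maximizers of perturbed upper semicontinuous functions *)

Section argmax.
Context {R : realType} {X : topologicalType}.
Implicit Types (K : set X) (G psi : X -> R).

Definition argmax K G : set X := [set x | K x /\ forall y, K y -> G y <= G x].

Definition usc_within K G : Prop := forall x c, K x -> G x < c ->
  \forall y \near x, K y -> G y < c.

Lemma usc_withinD K G psi : usc_within K G -> continuous psi ->
  usc_within K (fun x => G x + psi x).
Proof.
move=> uscG cpsi x c Kx Gc; pose d := (c - (G x + psi x)) / 2.
have d0 : 0 < d by rewrite divr_gt0 ?subr_gt0.
have near_G : \forall y \near x, K y -> G y < G x + d.
  by apply: uscG => //; rewrite ltrDl.
have near_psi : \forall y \near x, psi y < psi x + d.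
  by apply: (cvgr_lt _ (cpsi x)); rewrite ltrDl.
near=> y => Ky; have Gy : G y < G x + d by apply: (near near_G).
have : psi y < psi x + d by apply: (near near_psi).
by rewrite /d in Gy *; lra.
Unshelve. all: by end_near. Qed.

Variables (K : set X) (G psi : X -> R) (x0 : X).
Hypothesis compactK : compact K.
Hypothesis uscG : usc_within K G.
Hypothesis cpsi : continuous psi.
Hypothesis x0max : argmax K G x0.
Hypothesis psi_le : forall x, argmax K G x -> psi x <= psi x0.

Lemma argmax_perturbation e : 0 < e -> \forall t \near 0^'+,
  argmax K (fun x => G x + t * psi x) `<=` [set x | psi x < psi x0 + e].
Proof.
move=> e0; have [Kx0 G_le] := x0max.
have : \forall t \near (0 : R)^'+, K `<=`
    [set x | psi x0 + e <= psi x -> G x + t * psi x < G x0 + t * psi x0].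
  apply: ((near_covering_withinP K).2 ((compact_near_coveringP K).1 compactK)).
  move=> x Kx; have [psix|psix] := ltP (psi x) (psi x0 + e).
    have near_psi : \forall y \near x, psi y < psi x0 + e.
      exact: (cvgr_lt _ (@cpsi x) _ psix).
    by near=> y t => _ /=; rewrite leNgt (near near_psi).
  have Gx : G x < G x0.
    rewrite ltNge; apply/negP => G_ge.
    have /psi_le : argmax K G x by split=> // y /G_le/le_trans; exact.
    lra.
  pose d := (G x0 - G x) / 2; have d0 : 0 < d by rewrite divr_gt0 ?subr_gt0.
  pose w := psi x - psi x0 + 1; have w0 : 0 < w by rewrite /w; lra.
  have near_G : \forall y \near x, K y -> G y < G x0 - d.
    by apply: uscG => //; rewrite /d; lra.
  have near_psi : \forall y \near x, psi y < psi x + 1.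
    by apply: (cvgr_lt _ (@cpsi x)); rewrite ltrDl.
  near=> y t => /= Ky _.
  have t0 : 0 < t by near: t; exact: nbhs_right_gt.
  have : t * w < d.
    rewrite -ltr_pdivlMr//; near: t; apply: nbhs_right_lt.
    by rewrite divr_gt0.
  have Gy : G y < G x0 - d by apply: (near near_G).
  have psiy : psi y < psi x + 1 by apply: (near near_psi).
  have : t * (psi y - psi x0) <= t * w by rewrite ler_pM2l// /w; lra.
  lra.
apply: filterS => t Kt x [Kx x_max] /=.
rewrite ltNge; apply/negP => /(Kt x Kx) /=.
by rewrite ltNge x_max.
Unshelve. all: by end_near. Qed.

(* Danskin's theorem: [t |-> max_K (G + t * psi)] has right derivative at most
   [psi x0] at [0]. *)
Lemma argmax_slope a b :
  (forall t, 0 < t -> exists2 x, argmax K (fun x => G x + t * psi x) x &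
    G x0 + a * t - b * t ^+ 2 <= G x + t * psi x) -> a <= psi x0.
Proof.
move=> growth; apply/ler_addgt0Pr => e e0.
have slope_cvg : a - b * t @[t --> (0 : R)^'+] --> a.
  rewrite -[X in _ --> X]subr0 -[X in _ --> _ - X](mulr0 b).
  apply: cvgB; first exact: cvg_cst.
  by apply: cvgMl_tmp; exact: cvg_at_right_filter.
apply: cvgr_to_le slope_cvg _; near=> t.
have t0 : 0 < t by near: t; exact: nbhs_right_gt.
have [x xmax x_growth] := growth t t0.
have psix : psi x < psi x0 + e.
  by move: x xmax {x_growth}; near: t; exact: argmax_perturbation.
have Gx : G x <= G x0 by apply: x0max.2; exact: xmax.1.
rewrite -(ler_pM2l t0).
have : t * psi x <= t * (psi x0 + e) by rewrite ler_pM2l// ltW.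
by move: x_growth; rewrite expr2; lra.
Unshelve. all: by end_near. Qed.

End argmax.

Lemma continuous_rV (R : numFieldType) (X : topologicalType) (m : nat)
    (phi : X -> 'rV[R]_m) :
  (forall i, continuous (fun x => phi x ord0 i)) -> continuous phi.
Proof.
move=> cphi x A [B Bphi BA]; near=> y; apply: BA => i j.
move: i j; near: y; apply: filter_forall => i; apply: filter_forall => j.
by have := Bphi i j; rewrite ord1; exact: cphi.
Unshelve. all: by end_near. Qed.

Section dot.
Context {R : realType} {m : nat}.
Implicit Types (u v w : 'rV[R]_m) (a : R).

Definition dot u v : R := \sum_i u ord0 i * v ord0 i.

Lemma dotC u v : dot u v = dot v u.
Proof. by apply: eq_bigr => i _; rewrite mulrC. Qed.

Lemma dotDl u v w : dot (u + v) w = dot u w + dot v w.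
Proof. by rewrite -big_split; apply: eq_bigr => i _; rewrite mxE mulrDl. Qed.

Lemma dotZl a u v : dot (a *: u) v = a * dot u v.
Proof. by rewrite mulr_sumr; apply: eq_bigr => i _; rewrite mxE mulrA. Qed.

Lemma dotBl u v w : dot (u - v) w = dot u w - dot v w.
Proof. by rewrite dotDl -scaleN1r dotZl mulN1r. Qed.

Lemma dotDr u v w : dot u (v + w) = dot u v + dot u w.
Proof. by rewrite ![dot u _]dotC dotDl. Qed.

Lemma dotZr a u v : dot u (a *: v) = a * dot u v.
Proof. by rewrite ![dot u _]dotC dotZl. Qed.

Lemma dotBr u v w : dot u (v - w) = dot u v - dot u w.
Proof. by rewrite ![dot u _]dotC dotBl. Qed.

Lemma dot0l u : dot 0 u = 0.
Proof. by rewrite -(scale0r 0) dotZl mul0r. Qed.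

Lemma coord_le_norm u i : `|u ord0 i| <= `|u|.
Proof.
by rewrite [leRHS]/normr/= mx_normrE; apply: (le_bigmax _ _ (ord0, i)).
Qed.

Lemma sqr_norm_le_dot u : `|u| ^+ 2 <= dot u u.
Proof.
have dot_ge0 : 0 <= dot u u by apply: sumr_ge0 => i _; rewrite -expr2 sqr_ge0.
have [/eqP ->|] := boolP (`|u| == 0); first by rewrite expr0n.
move=> /mx_norm_neq0[[j i] /= uE].
rewrite -[X in X ^+ 2]/(mx_norm u) uE ord1 real_normK ?num_real//.
rewrite /dot (bigD1 i)//= -expr2 lerDl.
by apply: sumr_ge0 => k _; rewrite -expr2 sqr_ge0.
Qed.

Lemma dot_le0 u : dot u u <= 0 -> u = 0.
Proof.
move=> /(le_trans (sqr_norm_le_dot u)) u0; apply/eqP.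
by rewrite -normr_eq0 -sqrf_eq0 eq_le u0 sqr_ge0.
Qed.

Lemma dot_le_norm u v : dot u v <= m%:R * (`|u| * `|v|).
Proof.
rewrite -[m in m%:R]card_ord -sumr_const mulr_suml ler_sum// => i _.
rewrite mul1r (le_trans (ler_norm _))// normrM ler_pM//; exact: coord_le_norm.
Qed.

Lemma continuous_dotl v : continuous (dot^~ v).
Proof.
apply: continuous_big => [|i _]; first exact: add_continuous.
by move=> u; apply: (cvgMr_tmp (F := nbhs u)); exact: coord_continuous.
Qed.

Lemma continuous_dot_self : continuous (fun u => dot u u).
Proof.
apply: continuous_big => [|i _]; first exact: add_continuous.
by move=> u; apply: (cvgM (F := nbhs u)); exact: coord_continuous.
Qed.

End dot.

Lemma coercive_EVT_min_rV (R : realType) (m : nat) (J : 'rV[R]_m -> R) (r : R) :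
  continuous J -> (forall u, r < `|u| -> J 0 <= J u) ->
  exists u, forall v, J u <= J v.
Proof.
move=> cJ Jr; pose A : set 'rV[R]_m := [set u | `|u| <= `|r|].
have A0 : A 0 by rewrite /A/= normr0.
have compactA : compact A.
  apply: bounded_closed_compact.
    exists `|r|; split; first exact: num_real.
    by move=> N rN u /le_trans; apply; exact: ltW.
  move/continuous_closedP : (@norm_continuous _ 'rV[R]_m).
  by move=> /(_ _ (@closed_le R `|r|)).
have [||u _ u_min] := @EVT_min_rV R m J A _ compactA.
- by exists 0.
- exact: continuous_subspaceT.
exists u => v; have [vA|] := leP `|v| `|r|.
  by apply: u_min; exact/mem_set.
move=> /(le_lt_trans (ler_norm r))/Jr; apply: le_trans.
by apply: u_min; exact/mem_set.
Qed.

Section proximal.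
Context {R : realType} {X : topologicalType} {m : nat}.
Variables (K : set X) (F : X -> R) (phi : X -> 'rV[R]_m).

Definition tilt (u : 'rV[R]_m) (x : X) : R := F x + dot u (phi x).

Definition envelope (u : 'rV[R]_m) : R := sup [set tilt u x | x in K].

Hypothesis compactK : compact K.
Hypothesis uscF : usc_within K F.
Hypothesis cphi : continuous phi.
Hypothesis argmax_unique : forall u, exists2 x, argmax K (tilt u) x &
  forall y, argmax K (tilt u) y -> phi y = phi x.

Lemma tiltDZ u v t : tilt (u + t *: v) = fun x => tilt u x + t * dot v (phi x).
Proof. by apply/funext => x; rewrite /tilt dotDl dotZl addrA. Qed.

Lemma envelope_argmax u x : argmax K (tilt u) x -> envelope u = tilt u x.
Proof.
move=> [Kx xmax]; apply/eqP; rewrite eq_le; apply/andP; split.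
  apply: ge_sup; first by exists (tilt u x), x.
  by move=> _ [y Ky <-]; exact: xmax.
by apply: ub_le_sup; [exists (tilt u x) => _ [y Ky <-]; exact: xmax|exists x].
Qed.

Lemma le_envelope u x : K x -> tilt u x <= envelope u.
Proof.
move=> Kx; have [y ymax _] := argmax_unique u.
by rewrite (envelope_argmax ymax); apply: ymax.2.
Qed.

Lemma continuous_dot_phi u : continuous (fun x => dot u (phi x)).
Proof.
under eq_fun do rewrite dotC.
move=> x; apply: (@continuous_comp _ _ _ phi (dot^~ u)); first exact: cphi.
exact: continuous_dotl.
Qed.

Lemma usc_tilt u : usc_within K (tilt u).
Proof. exact/(usc_withinD uscF)/continuous_dot_phi. Qed.

Lemma envelope_lipschitz : exists k, forall u v,
  envelope u - envelope v <= k * `|u - v|.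
Proof.
have /compact_bounded[M [_ phiM]] : compact (phi @` K).
  by apply: continuous_compact => //; exact: continuous_subspaceT.
exists (m%:R * (M + 1)) => u v; have [x xmax _] := argmax_unique u.
have Kx := xmax.1; have := le_envelope v Kx.
rewrite (envelope_argmax xmax) /tilt => x_le.
have := dot_le_norm (u - v) (phi x); rewrite dotBl => dot_le.
have phix : `|phi x| <= M + 1 by apply: phiM; [rewrite ltrDl|exists x].
have : m%:R * (`|u - v| * `|phi x|) <= m%:R * (M + 1) * `|u - v|.
  by rewrite -mulrA ler_wpM2l// mulrC ler_wpM2r.
lra.
Qed.

Lemma continuous_envelope : continuous envelope.
Proof.
have [k0 k0_lip] := envelope_lipschitz; pose k := `|k0| + 1.
have k_gt0 : 0 < k by rewrite ltr_wpDl.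
have k_lip u v : `|envelope u - envelope v| <= k * `|u - v|.
  have k0k : k0 * `|u - v| <= k * `|u - v|.
    by rewrite ler_wpM2r//; have := ler_norm k0; rewrite /k; lra.
  have := k0_lip u v; have := k0_lip v u; rewrite (distrC v u).
  by rewrite ler_norml; lra.
move=> u; apply: (cvgrPdist_lt (F := nbhs u) _ _).2 => e e0; near=> v.
apply: le_lt_trans (k_lip u v) _; rewrite mulrC -ltr_pdivlMr//.
near: v; apply: (cvgrPdist_lt (F := nbhs u) _ _).1 (@cvg_id _ (nbhs u)) _ _.
by rewrite divr_gt0.
Unshelve. all: by end_near. Qed.

Section proximal_objective.
Variables (x0 : X) (s : R).
Hypothesis Kx0 : K x0.
Hypothesis s0 : 0 < s.

Let objective u := envelope u - dot u (phi x0) + s / 2 * dot u u.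

Let objective_ge u : F x0 + s / 2 * dot u u <= objective u.
Proof. by have := le_envelope u Kx0; rewrite /objective /tilt; lra. Qed.

Let objective0 : objective 0 = envelope 0.
Proof. by rewrite /objective !dot0l subr0 mulr0 addr0. Qed.

Let continuous_objective : continuous objective.
Proof.
move=> u; apply: (cvgD (F := nbhs u)).
  apply: (cvgB (F := nbhs u)); first exact: continuous_envelope.
  exact: continuous_dotl.
by apply: (cvgMl_tmp (F := nbhs u)); exact: continuous_dot_self.
Qed.

Let objective_min : exists u, forall v, objective u <= objective v.
Proof.
pose B := objective 0 - F x0; pose q := 2 / s * B.
have B0 : 0 <= B by have := objective_ge 0; rewrite dot0l mulr0 addr0 subr_ge0.
have q0 : 0 <= q by rewrite mulr_ge0// divr_ge0// ltW.
apply: (coercive_EVT_min_rV (r := 1 + q) continuous_objective) => u u_gt.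
apply: le_trans (objective_ge u); rewrite -lerBlDl -/B.
have -> : B = s / 2 * q by rewrite /q; field; rewrite gt_eqF.
rewrite ler_pM2l ?divr_gt0//; apply: le_trans (sqr_norm_le_dot u).
by move: u_gt; nra.
Qed.

(* By [argmax_slope], the equation on [phi] is the first-order condition at a
   minimizer of the objective. *)
Lemma proximal_argmax : exists u x, [/\ argmax K (tilt u) x,
  phi x = phi x0 - s *: u & F x0 + s / 2 * dot u u <= envelope 0].
Proof.
have [u u_min] := objective_min; have [x xmax x_unique] := argmax_unique u.
exists u, x; split=> //; last first.
  by rewrite -objective0; exact: le_trans (objective_ge u) (u_min 0).
have slope_le v : dot v (phi x0 - s *: u) <= dot v (phi x).
  have dot_v_le y : argmax K (tilt u) y -> dot v (phi y) <= dot v (phi x).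
    by move=> /x_unique ->.
  apply: (argmax_slope compactK (usc_tilt (u := u)) (@continuous_dot_phi v) xmax
    dot_v_le (b := s / 2 * dot v v)) => t t0.
  have [y ymax _] := argmax_unique (u + t *: v); exists y.
    by rewrite -tiltDZ.
  have := u_min (u + t *: v); rewrite /objective.
  rewrite (envelope_argmax xmax) (envelope_argmax ymax) tiltDZ.
  by rewrite dotBr !(dotDl, dotDr, dotZl, dotZr) (dotC v u); lra.
apply/esym/eqP; rewrite -subr_eq0; apply/eqP/dot_le0.
by rewrite dotBr subr_le0 slope_le.
Qed.

End proximal_objective.

Theorem argmax_approximation (x0 : X) (e : R) : K x0 -> 0 < e ->
  exists u x, [/\ argmax K (tilt u) x, `|phi x - phi x0| <= e & F x0 <= F x].
Proof.
move=> Kx0 e0; pose B := envelope 0 - F x0.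
have B0 : 0 <= B.
  by have := le_envelope 0 Kx0; rewrite /tilt dot0l addr0 subr_ge0.
pose s := e ^+ 2 / (2 * B + 1).
have s0 : 0 < s by rewrite divr_gt0 ?exprn_gt0// ltr_wpDl// mulr_ge0.
have [u [x [xmax phix u_le]]] := proximal_argmax Kx0 s0.
exists u, x; split=> //.
- rewrite phix addrAC subrr add0r normrN normrZ gtr0_norm//.
  have su0 : 0 <= s * `|u| by rewrite mulr_ge0// ltW.
  rewrite -ler_sqr ?nnegrE ?(ltW e0)// exprMn.
  apply: (@le_trans _ _ (s * (2 * B))).
    rewrite [s ^+ 2]expr2 -mulrA ler_pM2l//.
    have : s * `|u| ^+ 2 <= s * dot u u by rewrite ler_pM2l// sqr_norm_le_dot.
    by move: u_le; rewrite addrC -lerBrDr -/B; lra.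
  by rewrite /s mulrAC ler_pdivrMr ?ler_pM2l ?exprn_gt0//; lra.
- have := le_envelope u Kx0.
  rewrite (envelope_argmax xmax) /tilt phix dotBr dotZr.
  have := le_trans (sqr_ge0 _) (sqr_norm_le_dot u).
  by move/(mulr_ge0 (ltW s0)); lra.
Qed.

End proximal.

(** * Density of sequences of continuous functions *)

Definition uniformly_dense (R : realType) (T : topologicalType)
    (V : set (T -> R)) : Prop :=
  forall g, continuous g -> forall e : R, 0 < e ->
    exists2 v, V v & forall x, `|g x - v x| < e.

Section compact_pseudometric.
Context {R : realType} {T : pseudoPMetricType R}.
Hypothesis compactT : compact [set: T].

Lemma compact_unif_continuous (U : pseudoMetricType R) (f : T -> U) :
  continuous f -> unif_continuous f.
Proof.
move=> cf; apply/unif_continuousP => e e0.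
have e2 : 0 < e / 2 by rewrite divr_gt0.
have : \forall r \near 0^'+, [set: T] `<=`
    [set x | forall y, ball x r y -> ball (f x) e (f y)].
  apply: ((compact_near_coveringP _).1 compactT) => x _.
  have /cf/nbhs_ballP[d /= d0 df] : nbhs (f x) (ball (f x) (e / 2)).
    exact: nbhsx_ballx.
  have d2 : 0 < d / 2 by rewrite divr_gt0.
  near=> x' r => /= y x'y.
  have xx' : ball x (d / 2) x' by near: x'; exact: nbhsx_ballx.
  have rd : r <= d / 2 by near: r; exact: nbhs_right_le.
  have fx' : ball (f x) (e / 2) (f x') by apply/df/(le_ball _ xx'); lra.
  have fy : ball (f x) (e / 2) (f y).
    apply: df; rewrite [d]splitr; apply: ball_triangle xx' _.
    exact: le_ball x'y.
  by rewrite [e]splitr; apply: ball_triangle fy; exact: ball_sym.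
move=> rf; near (0 : R)^'+ => r.
have r0 : 0 < r by near: r; exact: nbhs_right_gt.
have fr : [set: T] `<=` [set x | forall y, ball x r y -> ball (f x) e (f y)].
  by near: r.
by exists r => // -[x y] /=; exact: fr.
Unshelve. all: by end_near. Qed.

Definition partition_of_unity (r : R) (s : seq T) (psi : nat -> T -> R) :
    Prop :=
  [/\ forall i, continuous (psi i), forall i x, 0 <= psi i x,
      forall x, \sum_(i < size s) psi i x = 1 &
      forall i x, psi i x != 0 -> ball (nth point s i) r x].

Lemma exists_partition_of_unity (r : R) : 0 < r ->
  exists s psi, partition_of_unity r s psi.
Proof.
move=> r0; have /choice[b bP] : forall z : T, exists g : T -> R,
    bump (ball z r)° g /\ g z = 1.
  move=> z; have [|g] := @exists_bump R T (ball z r)° z (@open_interior _ _).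
    exact: nbhsx_ballx.
  by exists g.
have cb z : continuous (b z) by have [[]] := bP z.
have b_ge0 z x : 0 <= b z x by have [[_ + _] _] := bP z; move/(_ x)/andP => [].
have b_supp z x : b z x != 0 -> ball z r x.
  have [[_ _ b0] _] := bP z; apply: contraNP => zx; apply/eqP/b0.
  by apply: contra_not zx; exact: interior_subset.
have := compactT; rewrite compact_cover.
move=> /(_ T setT (fun z => [set x | 0 < b z x]))[z _|x _|D _ covD].
- by have /continuousP/(_ _ (@open_gt R 0)) := cb z.
- by exists x => //=; have [_ ->] := bP x.
pose s := enum_fset D; pose S x := \sum_(z <- s) b z x.
have S0 x : 0 < S x.
  have [z /= zD bz] := covD x I; rewrite /S (big_rem z)//= ltr_pwDl//.
  by apply: sumr_ge0 => y _; exact: b_ge0.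
have cS : continuous S by apply: continuous_big => //; exact: add_continuous.
exists s, (fun i x => b (nth point s i) x / S x); split=> [i x|i x|x|i x].
- apply: cvgM; first exact: cb.
  by apply: cvgV; [rewrite gt_eqF|exact: cS].
- by rewrite divr_ge0// ltW.
- rewrite -mulr_suml -(big_mkord xpredT (fun i => b (nth point s i) x)).
  by rewrite -(big_nth point xpredT (fun z => b z x)) divff// (gt_eqF (S0 x)).
- by rewrite mulf_eq0 negb_or => /andP[/b_supp].
Qed.

Lemma rational_partition_approx (r e : R) (s : seq T) (psi : nat -> T -> R)
    (g : T -> R) :
  partition_of_unity r s psi -> 0 < e ->
  (forall x y, ball x r y -> `|g x - g y| < e) ->
  exists q : seq rat, forall x,
    `|g x - \sum_(i < size s) ratr q`_i * psi i x| <= e + e.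
Proof.
move=> [_ psi0 psi1 psir] e0 ge.
have /choice[Q Qe] : forall y : R, exists q : rat, `|y - ratr q| < e.
  move=> y; have /rat_in_itvoo[q] : y - e < y + e by lra.
  by rewrite in_itv/= => /andP[? ?]; exists q; rewrite ltr_norml; lra.
exists [seq Q (g z) | z <- s] => x.
rewrite -{1}[g x]mulr1 -{1}(psi1 x) mulr_sumr -sumrB.
rewrite -[leRHS]mulr1 -(psi1 x) mulr_sumr.
apply: (le_trans (ler_norm_sum _ _ _)); apply: ler_sum => i _.
rewrite -mulrBl normrM (ger0_norm (psi0 i x)).
have [->|/psir zx] := eqVneq (psi i x) 0; first by rewrite !mulr0.
rewrite ler_wpM2r// (nth_map point)//.
apply: le_trans (ler_distD (g (nth point s i)) _ _) _.
by apply: lerD; apply: ltW; [rewrite distrC; exact: ge|exact: Qe].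
Qed.

Lemma uniformly_dense_sequence (V : set (T -> R)) : uniformly_dense V ->
  exists v : nat -> T -> R, (forall n, V (v n)) /\ uniformly_dense (range v).
Proof.
move=> denseV; have mesh_gt0 n : 0 < n.+1%:R^-1 :> R by rewrite invr_gt0.
have /choice[p p_unity] n : exists p : seq T * (nat -> T -> R),
    partition_of_unity n.+1%:R^-1 p.1 p.2.
  by have [s [psi]] := exists_partition_of_unity (mesh_gt0 n); exists (s, psi).
pose G (c : nat * seq rat) x :=
  \sum_(i < size (p c.1).1) ratr c.2`_i * (p c.1).2 i x : R.
have cG c : continuous (G c).
  apply: continuous_big => [|i _]; first exact: add_continuous.
  by move=> x; apply: cvgMl_tmp; have [+ _ _ _] := p_unity c.1; exact.
have /choice[w wP] c : exists w, V w /\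
    forall x, `|G c x - w x| < c.1.+1%:R^-1.
  by have [w Vw Gw] := denseV _ (cG c) _ (mesh_gt0 c.1); exists w.
pose decode (n : nat) : nat * seq rat := odflt (0%N, [::]) (unpickle n).
exists (fun n => w (decode n)); split=> [n|g cg e e0].
  by case: (wP (decode n)).
have e4 : 0 < e / 4 by rewrite divr_gt0.
have /unif_continuousP/(_ _ e4)[r r0 gr] := compact_unif_continuous cg.
near \oo => n.
have nr : n.+1%:R^-1 < r by near: n; exact: near_infty_natSinv_lt (PosNum r0).
have ne : n.+1%:R^-1 < e / 4.
  by near: n; exact: near_infty_natSinv_lt (PosNum e4).
have [x y xy|q Gq] := @rational_partition_approx _ _ _ _ g (p_unity n) e4.
  by apply: (gr (x, y)) => /=; exact: le_ball (ltW nr) _ xy.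
exists (w (n, q)).
  by exists (pickle (n, q)) => //=; rewrite /decode pickleK.
move=> x; have gG : `|g x - G (n, q) x| <= e / 4 + e / 4 := Gq x.
have [_ /(_ x)/lt_trans/(_ ne) Gw] := wP (n, q).
by apply: le_lt_trans (ler_distD (G (n, q) x) (g x) _) _; lra.
Unshelve. all: by end_near. Qed.

End compact_pseudometric.

(** * Equilibrium states *)

Lemma weak_star_cvg_dense (R : realType) (T : ptopologicalType) (I : Type)
    (F : set_system I) (P_ : I -> probability (borel T) R)
    (P : probability (borel T) R) (v : nat -> T -> R) :
  compact [set: T] -> Filter F -> (forall i, continuous (v i)) ->
  uniformly_dense (range v) ->
  (forall i, \int[P_ n]_x v i x @[n --> F] --> \int[P]_x v i x) ->
  P_ n @[n --> F] --> P.
Proof.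
move=> compactT FF cv dense_v vP; apply/weak_star_cvgP => g cg.
apply/cvgrPdist_lt => e e0; have e3 : 0 < e / 3 by rewrite divr_gt0.
have [_ [i _ <-] gv] := dense_v g cg _ e3.
have gvle x : `|g x - v i x| <= e / 3 by exact: ltW.
have /cvgrPdist_lt/(_ _ e3) := vP i; apply: filterS => n /=.
have := mean_dist (Rintegral_mean compactT P) cg (cv i) gvle.
have := mean_dist (Rintegral_mean compactT (P_ n)) cg (cv i) gvle.
by rewrite !ler_norml !ltr_norml; lra.
Qed.

Section equilibrium.
Context {R : realType} {T : pseudoPMetricType R} {k : acting_monoid} {l : nat}.
Variable tau : lat k l -> T -> T.
Hypothesis compactT : compact [set: T].
Hypothesis continuous_tau : forall a, continuous (tau a).
Hypothesis entropy_fin : forall mu : probability (borel T) R,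
  tau_invariant tau mu -> ms_entropy tau mu \is a fin_num.
Hypothesis usc : entropy_usc R tau.

Local Notation prob := (probability (borel T) R).
Local Notation invariant := [set mu : prob | tau_invariant tau mu].

Definition rentropy (mu : prob) : R := fine (ms_entropy tau mu).

Definition free_energy (g : T -> R) (mu : prob) : R :=
  \int[mu]_x g x + rentropy mu.

Lemma rentropyE mu :
  tau_invariant tau mu -> ms_entropy tau mu = (rentropy mu)%:E.
Proof. by move=> imu; rewrite /rentropy fineK ?entropy_fin. Qed.

Lemma equilibrium_state_argmax (g : T -> R) (mu : prob) : continuous g ->
  equilibrium_state tau g mu <-> argmax invariant (free_energy g) mu.
Proof.
move=> cg; have energyE (nu : prob) : tau_invariant tau nu ->
    (pairing nu g + ms_entropy tau nu)%E = (free_energy g nu)%:E.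
  by move=> inu; rewrite pairing_Rintegral// rentropyE.
split=> -[imu mu_max]; split=> //.
  move=> nu inu; rewrite -lee_fin -!energyE// mu_max.
  by apply: ereal_sup_ubound; exists nu.
apply/eqP; rewrite eq_le; apply/andP; split.
  by apply: ereal_sup_ubound; exists mu.
by apply: ge_ereal_sup => _ [nu inu <-]; rewrite !energyE// lee_fin mu_max.
Qed.

Lemma compact_invariant : compact invariant.
Proof.
apply: (subclosed_compact _ (compact_probability compactT)) => //.
rewrite (_ : mkset _ =
  \bigcap_(a in setT) [set mu : prob | measure_preserving (tau a) mu]).
  by apply: closed_bigI => a _; exact: closed_measure_preserving.
by apply/seteqP; split=> mu /= imu a => [_|]; exact: imu.
Qed.

Lemma usc_rentropy : usc_within invariant rentropy.
Proof.
move=> mu c imu muc; have [|m [gs [e [e0 cgs nbhd]]]] := usc imu (c := c).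
  by rewrite rentropyE// lte_fin.
have near_gs : nbhs mu [set nu : prob | forall i : 'I_m,
    `|\int[mu]_x gs i x - \int[nu]_x gs i x| < e].
  apply: (filter_forall (F := nbhs mu)) => i.
  have cgsi := @continuous_Rintegral R T (gs i) (cgs i) mu.
  exact: (cvgrPdist_lt (F := nbhs mu) _ _).1 cgsi _ e0.
apply: filterS near_gs => nu nu_gs inu.
rewrite -lte_fin -rentropyE//; apply: nbhd => // i.
by rewrite !pairing_Rintegral// -EFinB lte_fin distrC.
Qed.

Lemma usc_free_energy (g : T -> R) :
  continuous g -> usc_within invariant (free_energy g).
Proof.
move=> cg; rewrite (_ : free_energy g = fun mu => rentropy mu + \int[mu]_x g x).
  exact: usc_withinD usc_rentropy (continuous_Rintegral cg).
by apply/funext => mu; rewrite addrC.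
Qed.

Lemma cvg_rentropy (g : T -> R) (mu_ : nat -> prob) (mu : prob) :
  continuous g ->
  (forall n, tau_invariant tau (mu_ n)) -> tau_invariant tau mu ->
  mu_ n @[n --> \oo] --> mu ->
  (forall n, free_energy g mu <= free_energy g (mu_ n)) ->
  rentropy (mu_ n) @[n --> \oo] --> rentropy mu.
Proof.
move=> cg imu_ imu mu_mu energy_le; apply/cvgrPdist_lt => e e0.
have near_ub : nbhs mu [set nu : prob | tau_invariant tau nu ->
    rentropy nu < rentropy mu + e].
  by apply: usc_rentropy => //; rewrite ltrDl.
have /weak_star_cvgP/(_ g cg)/cvgrPdist_lt/(_ _ e0) near_g := mu_mu.
near=> n; have := energy_le n; rewrite /free_energy.
have : rentropy (mu_ n) < rentropy mu + e.
  by move: (imu_ n); near: n; exact: mu_mu near_ub.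
have : `|\int[mu]_x g x - \int[mu_ n]_x g x| < e by near: n.
by rewrite !ltr_norml; lra.
Unshelve. all: by end_near. Qed.

Section density.
Variables (f : T -> R) (V : set (T -> R)).
Hypothesis cf : continuous f.
Hypothesis subspaceV : dense_subspace_C V.
Hypothesis unique_state :
  forall g, V g -> unique_equilibrium_state tau (fun x => f x + g x).

Let cV g : V g -> continuous g.
Proof. by case: subspaceV => _ _ _ + _; apply. Qed.

Let subspace_sum (m : nat) (u : 'I_m -> R) (v : 'I_m -> T -> R) :
  (forall i, V (v i)) -> V (fun x => \sum_(i < m) u i * v i x).
Proof.
have [V0 VD VZ _ _] := subspaceV; move=> Vv.
elim: (index_enum _) => [|i s ih]; first by under eq_fun do rewrite big_nil.
by under eq_fun do rewrite big_cons; apply: VD => //; exact: VZ.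
Qed.

Section finite_family.
Context {m : nat} (v : 'I_m -> T -> R).
Hypothesis Vv : forall i, V (v i).

Let integrals (mu : prob) : 'rV[R]_m := \row_i \int[mu]_x v i x.

Let comb (u : 'rV[R]_m) (x : T) : R := \sum_(i < m) u ord0 i * v i x.

Let continuous_integrals : continuous integrals.
Proof.
apply: continuous_rV => i; under eq_fun do rewrite mxE.
exact/continuous_Rintegral/cV.
Qed.

Let free_energy_comb u :
  free_energy (fun x => f x + comb u x) = tilt (free_energy f) integrals u.
Proof.
apply/funext => mu; rewrite /free_energy /tilt.
have meanmu := Rintegral_mean compactT mu.
have cuv i : continuous (fun x => u ord0 i * v i x).
  by move=> x; apply: cvgMl_tmp; exact: cV.
rewrite (meanD meanmu cf); last exact/cV/subspace_sum.
rewrite (mean_sum meanmu _ cuv) -!addrA; congr (_ + _).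
rewrite addrC; congr (_ + _); apply: eq_bigr => i _.
by rewrite mxE (meanZ meanmu)//; exact: cV.
Qed.

Lemma equilibrium_approximation (mu : prob) (e : R) :
  tau_invariant tau mu -> 0 < e ->
  exists g nu, [/\ V g, equilibrium_state tau (fun x => f x + g x) nu,
    forall i, `|\int[nu]_x v i x - \int[mu]_x v i x| <= e &
    free_energy f mu <= free_energy f nu].
Proof.
move=> imu e0; have Vcomb u : V (comb u) by exact: subspace_sum.
have cfcomb u : continuous (fun x => f x + comb u x).
  by move=> x; apply: cvgD; [exact: cf|exact: cV].
have unique_argmax u : exists2 nu,
    argmax invariant (tilt (free_energy f) integrals u) nu &
    forall nu', argmax invariant (tilt (free_energy f) integrals u) nu' ->
      integrals nu' = integrals nu.
  have [nu [nu_eq nu_unique]] := unique_state (Vcomb u); exists nu.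
    by rewrite -free_energy_comb; exact/equilibrium_state_argmax.
  rewrite -free_energy_comb => nu'.
  move=> /(equilibrium_state_argmax _ (cfcomb u))/nu_unique eq_nu.
  apply/rowP => i; rewrite !mxE; congr fine.
  by apply: eq_measure_integral => A mA _; exact: eq_nu.
have [u [nu [nu_max nu_near energy_le]]] :=
  argmax_approximation compact_invariant (usc_free_energy cf)
    continuous_integrals unique_argmax imu e0.
exists (comb u), nu; split=> // [|i].
  by apply/equilibrium_state_argmax => //; rewrite free_energy_comb.
apply: le_trans nu_near.
by have := coord_le_norm (integrals nu - integrals mu) i; rewrite !mxE.
Qed.

End finite_family.

Theorem equilibrium_state_density (mu : prob) : tau_invariant tau mu ->
  exists (mu_ : nat -> prob) (g_ : nat -> T -> R),
  [/\ forall n,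
        V (g_ n) /\ equilibrium_state tau (fun x => f x + g_ n x) (mu_ n),
      mu_ n @[n --> \oo] --> mu &
      rentropy (mu_ n) @[n --> \oo] --> rentropy mu].
Proof.
move=> imu; have dense_V : uniformly_dense V by case: subspaceV.
have [v [Vv dense_v]] := uniformly_dense_sequence compactT dense_V.
pose stage n (p : (T -> R) * prob) :=
  [/\ V p.1, equilibrium_state tau (fun x => f x + p.1 x) p.2,
      forall i, (i < n)%N ->
        `|\int[p.2]_x v i x - \int[mu]_x v i x| <= n.+1%:R^-1 &
      free_energy f mu <= free_energy f p.2].
have /choice[p p_stage] n : exists p, stage n p.
  have n0 : 0 < n.+1%:R^-1 :> R by rewrite invr_gt0.
  have [g [nu [Vg nu_eq nu_near energy_le]]] :=
    equilibrium_approximation (fun i : 'I_n => Vv i) imu n0.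
  by exists (g, nu); split=> // i ni; exact: (nu_near (Ordinal ni)).
have mu_cvg : (p n).2 @[n --> \oo] --> mu.
  apply: (weak_star_cvg_dense compactT _ (fun i => cV (Vv i)) dense_v) => i.
  apply/cvgrPdist_le => e e0; near=> n.
  have [_ _ /(_ i) near_i _] := p_stage n; rewrite distrC.
  apply: le_trans (near_i _) _; first by near: n; exact: nbhs_infty_gt.
  by apply: ltW; near: n; exact: near_infty_natSinv_lt (PosNum e0).
exists (fun n => (p n).2), (fun n => (p n).1); split=> // [n|].
  by have [] := p_stage n.
apply: (cvg_rentropy cf _ imu mu_cvg) => n; last by have [] := p_stage n.
by have [_ [imu_n _] _ _] := p_stage n.
Unshelve. all: by end_near. Qed.

End density.
End equilibrium.

Theorem theorem1 (R : realType) (Omega : pseudoPMetricType R)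
  (k : acting_monoid) (l : nat) (tau : lat k l -> Omega -> Omega)
  (f : Omega -> R) (V : set (Omega -> R)) :
  hausdorff_space Omega -> compact [set: Omega] -> (0 < l)%N ->
  is_action tau ->
  (forall mu : probability (borel Omega) R, tau_invariant tau mu -> ms_entropy tau mu \is a fin_num) ->
  entropy_usc R tau ->
  continuous f ->
  dense_subspace_C V ->
  (forall g, V g -> unique_equilibrium_state tau (fun x => f x + g x)) ->
  forall mu : probability (borel Omega) R, tau_invariant tau mu ->
  exists (mu_ : nat -> probability (borel Omega) R) (g_ : nat -> Omega -> R),
    [/\ (forall n, [/\ tau_invariant tau (mu_ n), V (g_ n) &
                     equilibrium_state tau (fun x => f x + g_ n x) (mu_ n)]),
        weak_star_cvg mu_ mu &
        (fun n => ms_entropy tau (mu_ n)) @ \oo --> ms_entropy tau mu].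
Proof.
move=> _ compactO _ [continuous_tau _ _] entropy_fin usc cf subspaceV unique.
move=> mu imu.
have [mu_ [g_ [state_mu mu_cvg entropy_cvg]]] := equilibrium_state_density
  compactO continuous_tau entropy_fin usc cf subspaceV unique imu.
have imu_ n : tau_invariant tau (mu_ n) by have [_ []] := state_mu n.
exists mu_, g_; split=> [n|g cg|].
- by have [] := state_mu n; split.
- rewrite pairing_Rintegral//; under eq_cvg do rewrite pairing_Rintegral//.
  apply: cvg_EFin; first exact: nearW.
  by move/weak_star_cvgP : mu_cvg => /(_ g cg).
- rewrite (rentropyE entropy_fin imu).
  under eq_cvg do rewrite (rentropyE entropy_fin (imu_ _)).
  by apply: cvg_EFin => //; exact: nearW.
Qed.
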